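(* Let $K:\mathbb{R}\to\mathbb{R}$, $\omega_2:\mathbb{R}^+\times\mathbb{R}^+\to\mathbb{R}$, $Q:\mathbb{R}^+\to\mathbb{R}^+$, where $\mathbb{R}^+=[0,+\infty)$, satisfy the following conditions. 1) $K(x)>0$ for $x\in\mathbb{R}$; $K(-t)=K(t)$ for $t\in\mathbb{R}^+$; $K$ is continuously differentiable on $\mathbb{R}$, and $K$ and $K'$ are bounded on $\mathbb{R}$. 2) $K$ monotonically decreases on $\mathbb{R}^+$ and $\int_0^\infty K(t)\,dt=\frac12$. 3) $\int_0^\infty xK(x)\,dx<+\infty$. 0) $Q(0)=0$ and $\omega_2(t,0)=0$ for all $t\in\mathbb{R}^+$. $b_1$) $\omega_2$ is continuous on $\mathbb{R}^+\times\mathbb{R}^+$ and, for each fixed $t\in\mathbb{R}^+$, the function $u\mapsto\omega_2(t,u)$ increases monotonically on $\mathbb{R}^+$ and is concave on $\mathbb{R}^+$. $b_2$) There exists a positive function $\mu_2$, summable on $\mathbb{R}^+$ and with zero limit at infinity, such that $\omega_2(t,u)\le\mu_2(t)u$ for all $t,u\in\mathbb{R}^+$. I) $Q$ is continuous and increases monotonically on $\mathbb{R}^+$. II) $Q$ is convex on $\mathbb{R}^+$ and there exists a number $\xi>0$ such that $Q(\xi)=(1+M)\xi$, where $M:=\int_0^\infty\mu_2(t)\,dt\cdot\sup_{x\in\mathbb{R}}K(x)$. III) There exists a continuous, monotonically increasing and concave map $\varphi:[0,1]\to[0,1]$ with $\varphi(0)=0$ and $\varphi(1)=1$ such that $G(\sigma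 u)\ge\varphi(\sigma)G(u)$ for all $\sigma\in(0,1)$ and $u\in(0,(1+M)\xi)$, where $G$ is the inverse function of $Q$ on $\mathbb{R}^+$. Let $F,\Phi,\eta$, the sequence $\{B_n\}_{n\ge0}$ and the function $\chi$ be as defined in the context. Then the integral equation $$Q(B(x))=\int_0^\infty\big(K(x-t)-K(x+t)\big)\big(B(t)+\omega_2(t,B(t))\big)\,dt,\qquad x\in\mathbb{R}^+,$$ has a non-negative, nontrivial, bounded and continuous solution $B$ on $\mathbb{R}^+$, namely $B(x)=\lim_{n\to\infty}B_n(x)$, with the following properties. (i) There is a number $\sigma_0\in(0,1)$ with $\sigma_0\le\chi(x)\le1$ for all $x>0$ such that, for an arbitrary $\varepsilon_0\in(0,1)$, setting $$k:=\frac{1-\varphi(\varepsilon_0\sigma_0)}{1-\varepsilon_0\sigma_0}\in(0,1),\qquad C:=\frac{\xi(1-\sigma_0)}{1-k},$$ one has $$0\le B_n(x)-B(x)\le C\,k^{n+1},\qquad n=0,1,2,\ldots,\ x\in\mathbb{R}^+.$$ (ii) $F(x)\le B(x)\le\Phi(x)$ for all $x\in\mathbb{R}^+$, $\lim_{x\to+\infty}B(x)=\eta$, and $\eta-B\in L_1(\mathbb{R}^+)$.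
   Context: $\mathbb{R}^+:=[0,+\infty)$. Under the hypotheses of the claim, the following objects are used. - $\eta>0$ denotes a positive fixed point of the map $y=Q(u)$, i.e. $Q(\eta)=\eta$; its existence is taken to follow from I) and II). - $F$ denotes the unique non-negative, nontrivial, monotonically non-decreasing, continuous and bounded solution on $\mathbb{R}^+$ of $$Q(F(x))=\int_0^\infty\big(K(x-t)-K(x+t)\big)F(t)\,dt,\quad x\in\mathbb{R}^+.$$ Its existence and uniqueness are taken from earlier literature, together with the properties $F(0)=0$, $F(x)>0$ for $x>0$, $\lim_{x\to+\infty}F(x)=\eta$, $\eta-F\in L_1(\mathbb{R}^+)$. - $\Phi$ denotes the unique non-negative, nontrivial, continuous and bounded solution on $\mathbb{R}^+$ of $$Q(\Phi(x))=\int_0^\infty\big(K(x-t)-K(x+t)\big)\big(1+\mu_2(t)\big)\Phi(t)\,dt,\quad x\in\mathbb{R}^+.$$ Its existence and uniqueness are taken from earlier literature, together with the properties $\Phi(0)=0$, $\xi>\Phi(x)>F(x)$ for $x>0$, $\lim_{x\to+\infty}\Phi(x)=\eta$, $\eta-\Phi\in L_1(\mathbb{R}^+)$. - The successive approximations $B_n$ are defined by $B_0(x)=\Phi(x)$ and $$Q(B_{n+1}(x))=\int_0^\infty\big(K(x-t)-K(x+t)\big)\big(B_n(t)+\omega_2(t,B_n(t))\big)\,dt,\quad n=0,1,2,\ldots,\ x\in\mathbb{R}^+.$$ - The function $\chi$ is defined for $x\in(0,+\infty)$ by $$\chi(x):=\frac{\int_0^\infty\big(K(x-t)-K(x+t)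\big)\big(\Phi(t)+\omega_2(t,\Phi(t))\big)\,dt}{\int_0^\infty\big(K(x-t)-K(x+t)\big)\big(1+\mu_2(t)\big)\Phi(t)\,dt}.$$
   Formalization: The formal statement additionally assumes that φ is not the identity map on [0,1]; for φ(σ)=σ, which condition III) permits, one gets k=1, so k∈(0,1) fails and C is undefined. *)

(* Defs.v *)
From HB Require Import structures.
From mathcomp Require Export all_boot all_order all_algebra.
From mathcomp Require Export all_classical all_reals all_analysis.

Set Implicit Arguments.
Unset Strict Implicit.
Unset Printing Implicit Defensive.

Import Order.TTheory GRing.Theory Num.Theory.
Import numFieldNormedType.Exports.

Local Open Scope classical_set_scope.
Local Open Scope ring_scope.

(* A function on [0, +oo[ is encoded as a total function R -> R of which only
   the restriction to Rplus is ever constrained. *)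
Definition Rplus {R : realType} : set R := `[0, +oo[.

Definition concave_on {R : realType} (A : set R) (f : R -> R) : Prop :=
  convex_function (A : set R^o) (fun x : R^o => - f x : R^o).

Definition increasing_on {R : realType} (A : set R) (f : R -> R) : Prop :=
  {in A &, {homo f : x y / x < y}}.

Definition decreasing_on {R : realType} (A : set R) (f : R -> R) : Prop :=
  {in A &, {homo f : x y /~ x < y}}.

(* Rintegral returns 0 when the Lebesgue integral is infinite. This never
   happens below: K is bounded and integrable, and f is always the sum of a
   bounded function and a function summable on Rplus. *)
Definition odd_convolution {R : realType} (K f : R -> R) (x : R) : R :=
  \int[@lebesgue_measure R]_(t in Rplus) ((K (x - t) - K (x + t)) * f t).

Definition mass {R : realType} (K mu2 : R -> R) : R :=
  (\int[@lebesgue_measure R]_(t in Rplus) mu2 t) * sup (range K).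

(* The right-hand sides of the equations for F, Phi and B respectively. *)
Definition op_F {R : realType} (K f : R -> R) : R -> R :=
  odd_convolution K f.

Definition op_Phi {R : realType} (K mu2 f : R -> R) : R -> R :=
  odd_convolution K (fun t => (1 + mu2 t) * f t).

Definition op_B {R : realType} (K : R -> R) (omega2 : R -> R -> R)
    (f : R -> R) : R -> R :=
  odd_convolution K (fun t => f t + omega2 t (f t)).

Definition is_solution {R : realType} (Q : R -> R)
    (T : (R -> R) -> R -> R) (f : R -> R) : Prop :=
  [/\ forall x, 0 <= x -> 0 <= f x,
      exists2 x, 0 <= x & f x != 0,
      {within Rplus, continuous f},
      [bounded f x | x in Rplus] &
      forall x, 0 <= x -> Q (f x) = T f x].

(* 0 <= B_ n x records that Q is only defined on Rplus. *)
Definition successive_approximations {R : realType} (Q : R -> R)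
    (T : (R -> R) -> R -> R) (Phi : R -> R) (B_ : nat -> R -> R) : Prop :=
  [/\ forall x, 0 <= x -> B_ 0%N x = Phi x,
      forall n x, 0 <= x -> 0 <= B_ n x &
      forall n x, 0 <= x -> Q (B_ n.+1 x) = T (B_ n) x].

Definition chi {R : realType} (K : R -> R) (omega2 : R -> R -> R)
    (mu2 Phi : R -> R) (x : R) : R :=
  op_B K omega2 Phi x / op_Phi K mu2 Phi x.

(* Main.v *)
Require Import Defs.
From mathcomp Require Import all_boot all_order all_algebra.
From mathcomp Require Import all_classical all_reals all_analysis.
From mathcomp Require Import measurable_realfun ring lra.
Set Implicit Arguments.
Unset Strict Implicit.
Unset Printing Implicit Defensive.
Import Order.TTheory GRing.Theory Num.Theory.
Import numFieldNormedType.Exports.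
Local Open Scope classical_set_scope.
Local Open Scope ring_scope.

(** Write [T f] for [odd_convolution K f].  Its kernel
    [K (x - t) - K (x + t)] is nonnegative on the quadrant, because [K] is
    even and decreasing, and its integral against any measurable function
    bounded by a multiple of [1 + mu2] is finite and continuous in [x].  As
    [Q] is increasing, order relations between sources pass to the solutions:
    [u <= u + omega2 t u <= (1 + mu2 t) u] yields
    [F <= B_ n.+1 <= B_ n <= Phi].

    The speed of convergence comes from comparing ratios instead of
    differences.  If [s B_ n <= B_ n.+1] with [0 < s < 1], then concavity of
    [omega2 t] and [omega2 t 0 = 0] give
    [s Q (B_ n.+1) = s T (B_ n + omega2 B_ n)
     <= T (B_ n.+1 + omega2 B_ n.+1) = Q (B_ n.+2)],
    and the condition on [G] turns this into [phi s B_ n.+1 <= B_ n.+2]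
    ([B_ratio]).  So the ratio improves from [s] to [phi s] at each step, and
    since [phi] is concave with [phi 1 = 1], the distance [1 - s] shrinks by
    the slope [k] of a chord of [phi] ending at [1] ([concave_chord]).  Hence
    [B_ n - B_ n.+1] decays geometrically, uniformly in [x] ([B_step_le]).

    The iteration starts because [chi] is bounded below
    ([op_B_ge_op_Phi]).  Away from [0] this holds because the numerator is at
    least [Q (F x)], which is nondecreasing and positive, while the
    denominator is at most [Q xi].  Near [0], where both
    vanish, the quotient is at least [T Phi / (T Phi + T (mu2 Phi))]: [K'] is
    bounded, so that [T (mu2 Phi) x <= d x], and [K'] is negative near some
    point, so that [T Phi x >= b x] for small [x], with [b > 0].

    The limit [B] is continuous as a uniform limit, and it solves the equation
    since concavity makes [omega2 t] Lipschitz with constant [mu2 t], which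
    bounds [T (B_ n + omega2 B_ n) - T (B + omega2 B)] by
    [sup (B_ n - B)] times [T (1 + mu2)] ([limit_solution]). *)

(** * Functions on the half-line *)

Section half_line.
Context {R : realType}.
Implicit Types (f g : R -> R) (x y t : R).
Local Notation lam := (@lebesgue_measure R).

Lemma in_Rplus x : (x \in (Rplus : set R)) = (0 <= x).
Proof. by rewrite /Rplus mem_setE in_itv /= andbT. Qed.

Lemma RplusE x : Rplus x = (0 <= x) :> Prop.
Proof. by rewrite /Rplus /= in_itv /= andbT. Qed.

Lemma measurable_Rplus : measurable (Rplus : set (measurableTypeR R)).
Proof. exact: measurable_itv. Qed.

(** Continuity at [0] is one-sided, so that the values at negative arguments
    never enter. *)
Lemma continuous_RplusP f : {within Rplus, continuous f} <->
  forall x, 0 <= x -> forall e, 0 < e -> exists2 d, 0 < d &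
    forall y, 0 <= y -> `|x - y| < d -> `|f x - f y| < e.
Proof.
split.
- move=> /subspace_continuousP cf x x0 e e0.
  have {}cf := cf x; rewrite RplusE in cf.
  have /cvgrPdist_lt /(_ e e0) := cf x0.
  rewrite near_withinE => /nbhs_ballP[d d0 H]; exists d => // y y0 xy.
  by apply: H => //; rewrite RplusE.
- move=> H; apply/subspace_continuousP => x; rewrite RplusE => x0.
  apply/cvgrPdist_lt => e e0; rewrite near_withinE.
  have [d d0 Hd] := H x x0 e e0.
  apply/nbhs_ballP; exists d => //= y xy; rewrite RplusE => y0; exact: Hd.
Qed.

Lemma measurable_fun_Rplus f : {within Rplus, continuous f} ->
  measurable_fun Rplus f.
Proof.
move=> cf; apply: subspace_continuous_measurable_fun => //.
exact: measurable_Rplus.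
Qed.

Lemma bounded_onP (A : set R) f : [bounded f x | x in A] <->
  exists M, forall x, A x -> `|f x| <= M.
Proof.
split.
- move=> [M [Mr H]]; exists (M + 1) => x Ax; apply: (H (M + 1)) => //.
  by rewrite ltrDl.
- move=> [M H]; exists M; split; first exact: num_real.
  by move=> N MN x Ax; apply: (le_trans (H _ Ax)); exact: ltW.
Qed.

End half_line.


(** * Concave and increasing functions *)

Section concave_increasing.
Context {R : realType}.
Implicit Types (h phi : R -> R) (A : set R) (s u v m : R).

Lemma concave_on_conv A h x y s : concave_on A h -> A x -> A y ->
  0 <= s <= 1 -> s * h x + (1 - s) * h y <= h (s * x + (1 - s) * y).
Proof.
move=> ch Ax Ay /andP[s0 s1].
have := ch (Itv01 s0 s1) x y (mem_set Ax) (mem_set Ay).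
rewrite !convRE /= /unstable.onem; lra.
Qed.

Lemma concave_star h s u : concave_on Rplus h -> h 0 = 0 -> 0 <= s <= 1 ->
  0 <= u -> s * h u <= h (s * u).
Proof.
move=> ch h0 s01 u0.
have := @concave_on_conv Rplus h u 0 s ch.
by rewrite !RplusE h0 !mulr0 !addr0; apply.
Qed.

(** The slopes [h u / u] of a concave function vanishing at [0] decrease, so a
    linear bound [h w <= m w] controls its increments too. *)
Lemma concave_lipschitz h m u v : concave_on Rplus h -> h 0 = 0 ->
  (forall w, 0 <= w -> h w <= m * w) -> 0 <= v <= u ->
  h u - h v <= m * (u - v).
Proof.
move=> ch h0 hm /andP[v0 vu].
have [u_eq0|u_neq0] := eqVneq u 0.
  have v_eq0 : v = 0 by lra.
  by rewrite u_eq0 v_eq0 !subrr mulr0.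
have u0 : 0 < u by rewrite lt_def u_neq0 (le_trans v0 vu).
have s01 : 0 <= v / u <= 1.
  by rewrite divr_ge0 ?(ltW u0)// ler_pdivrMr// mul1r.
have := concave_star ch h0 s01 (ltW u0); rewrite divfK // => hv.
apply: (@le_trans _ _ ((1 - v / u) * h u)); first by lra.
have -> : m * (u - v) = (1 - v / u) * (m * u) by field.
by apply: ler_wpM2l; [lra|exact/hm/ltW].
Qed.

(** The slope of the chord of [phi] from [s] to [1] decreases in [s]: this is
    the contraction estimate for the iterates of [phi]. *)
Lemma concave_chord phi s0 s : concave_on `[0, 1] phi -> phi 1 = 1 ->
  0 <= s0 < 1 -> s0 <= s <= 1 ->
  1 - phi s <= (1 - phi s0) / (1 - s0) * (1 - s).
Proof.
move=> cphi phi1 /andP[s00 s01] /andP[s0s s1].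
have d0 : 0 < 1 - s0 by lra.
have l01 : 0 <= (1 - s) / (1 - s0) <= 1.
  by rewrite divr_ge0 ?(ltW d0) ?subr_ge0//= ler_pdivrMr// mul1r; lra.
have := @concave_on_conv `[0, 1] phi s0 1 _ cphi _ _ l01.
rewrite /= !in_itv /= ler01 lexx s00 (ltW s01) phi1 => /(_ isT isT).
have -> : (1 - s) / (1 - s0) * s0 + (1 - (1 - s) / (1 - s0)) * 1 = s.
  by field; rewrite gt_eqF.
have -> : (1 - phi s0) / (1 - s0) * (1 - s) =
  (1 - phi s0) * ((1 - s) / (1 - s0)) by field; rewrite gt_eqF.
lra.
Qed.

(** A concave function that meets the diagonal at one interior point as well
    as at [0] and [1] would coincide with it: strict inequality at one point
    propagates to both sides along chords. *)
Lemma concave_above_id phi s : concave_on `[0, 1] phi -> phi 0 = 0 ->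
  phi 1 = 1 -> (exists2 r, 0 < r < 1 & phi r != r) -> 0 < s < 1 -> s < phi s.
Proof.
move=> cphi phi0 phi1 [r /andP[r0 r1] phir] /andP[s0 s1].
have i0 : `[0, 1]%classic (0 : R) by rewrite /= in_itv /= lexx ler01.
have star t u : 0 <= t <= 1 -> 0 <= u <= 1 -> t * phi u <= phi (t * u).
  move=> t01 u01; have := @concave_on_conv `[0, 1] phi u 0 t cphi _ i0 t01.
  by rewrite phi0 !mulr0 !addr0; apply; rewrite /= in_itv.
have rphi : r < phi r.
  rewrite lt_def phir; have := star r 1; rewrite phi1 !mulr1; apply; lra.
(* left of r the chord through 0 is used, right of r the one through 1 *)
have [sr|rs] := leP s r.
  have l01 : 0 <= s / r <= 1.
    by rewrite divr_ge0 ?(ltW r0) ?(ltW s0)//= ler_pdivrMr// mul1r.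
  have := star (s / r) r l01; rewrite divfK ?gt_eqF// => H.
  apply: (@lt_le_trans _ _ (s / r * phi r)); last by apply: H; lra.
  by rewrite mulrAC -mulrA ltr_pMr // ltr_pdivlMr // mul1r.
have := @concave_chord phi r s cphi phi1.
have r01 : 0 <= r < 1 by lra.
have rs1 : r <= s <= 1 by lra.
move=> /(_ r01 rs1) H.
suff : (1 - phi r) / (1 - r) * (1 - s) < 1 - s by lra.
by rewrite gtr_pMl ?subr_gt0// ltr_pdivrMr ?subr_gt0// mul1r; lra.
Qed.

End concave_increasing.

Section monotone.
Context {R : realType} (Q : R -> R).
Implicit Types (f : R -> R) (x y : R).
Hypothesis Q_incr : increasing_on Rplus Q.

Lemma increasing_le_mono : {in Rplus &, {mono Q : x y / x <= y}}.
Proof. exact: le_mono_in. Qed.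

Lemma increasing_lt_mono : {in Rplus &, {mono Q : x y / x < y}}.
Proof. exact: leW_mono_in increasing_le_mono. Qed.

(** The inverse of an increasing function is continuous even without
    knowing its range: the values [Q (f x + e)] and [Q (f x - e)] enclose
    [Q (f y)] for [y] near [x]. *)
Lemma continuous_of_increasing_comp f : (forall x, 0 <= x -> 0 <= f x) ->
  {within Rplus, continuous (Q \o f)} -> {within Rplus, continuous f}.
Proof.
move=> f0 /continuous_RplusP cQf; apply/continuous_RplusP => x x0 e e0.
have fx0 := f0 x x0.
have inR z : 0 <= z -> z \in (Rplus : set R) by rewrite in_Rplus.
have up : 0 < Q (f x + e) - Q (f x).
  by rewrite subr_gt0 increasing_lt_mono ?inR ?addr_ge0// ?ltrDl// ltW.
have [d1 d10 H1] := cQf x x0 _ up.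
have {}H1 y : 0 <= y -> `|x - y| < d1 -> f y < f x + e.
  move=> y0 /(H1 y y0) /=; rewrite distrC => /ltr_distlDr.
  rewrite addrCA subrr addr0 increasing_lt_mono ?inR ?f0 ?addr_ge0//.
  exact: ltW.
have [fxe|fxe] := ltP (f x) e.
  exists d1 => // y y0 xy; have := H1 y y0 xy; have := f0 y y0.
  by rewrite ltr_norml => *; apply/andP; split; lra.
have lo : 0 < Q (f x) - Q (f x - e).
  by rewrite subr_gt0 increasing_lt_mono ?inR ?subr_ge0// ltrBlDr ltrDl.
have [d2 d20 H2] := cQf x x0 _ lo.
exists (Num.min d1 d2); first by rewrite lt_min d10.
move=> y y0; rewrite lt_min => /andP[xy1 xy2].
have lt1 := H1 y y0 xy1.
have lt2 : f x - e < f y.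
  rewrite -increasing_lt_mono ?inR ?f0 ?subr_ge0//.
  by move: (H2 y y0 xy2) => /= /(le_lt_trans (ler_norm _)); lra.
by rewrite ltr_norml; apply/andP; split; lra.
Qed.

(** The condition on the inverse [G] restated in terms of [Q] alone: this
    is the form in which the iteration uses it. *)
Lemma inverse_scale (G phi : R -> R) xi s u w : Q 0 = 0 ->
  (forall u, 0 <= u -> 0 <= G u) ->
  {in Rplus, cancel G Q} -> {in Rplus, cancel Q G} ->
  (forall s u, 0 < s < 1 -> 0 < u < Q xi -> phi s * G u <= G (s * u)) ->
  0 < s < 1 -> 0 < u < xi -> 0 <= w -> s * Q u <= Q w -> phi s * u <= w.
Proof.
move=> Q0 G0 GK QK Gphi s01 /andP[u0 uxi] w0 sQ.
have u0' := ltW u0; have /andP[s0 _] := s01.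
have Qu : 0 < Q u < Q xi.
  rewrite -Q0 !increasing_lt_mono ?in_Rplus ?u0 ?uxi //.
  exact: le_trans u0' (ltW uxi).
have /andP[Qu0 _] := Qu.
have sQ0 : 0 <= s * Q u by rewrite mulr_ge0 // ltW.
have := Gphi s (Q u) s01 Qu; rewrite QK ?in_Rplus // => /le_trans; apply.
by rewrite -increasing_le_mono ?in_Rplus ?G0 // GK ?in_Rplus.
Qed.

End monotone.

(** * Limits of sequences *)

Section limits.
Context {R : realType}.
Implicit Types (f : R -> R) (x : R).

Lemma uniform_limit_continuous (f_ : nat -> R -> R) f (e : nat -> R) :
  (forall n, {within Rplus, continuous (f_ n)}) ->
  (forall n x, 0 <= x -> `|f_ n x - f x| <= e n) ->
  e n @[n --> \oo] --> (0 : R) ->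
  {within Rplus, continuous f}.
Proof.
move=> cf fe e0; apply/continuous_RplusP => x x0 d d0.
have d3 : 0 < d / 3 by lra.
have /cvgrPdist_lt /(_ _ d3)[N _ /(_ N (leqnn N))] := e0.
rewrite /= sub0r normrN => /(le_lt_trans (ler_norm _)) eN.
have /continuous_RplusP /(_ x x0 _ d3)[r r0 Hr] := cf N.
exists r => // y y0 xy.
have := Hr y y0 xy; have := fe N x x0; have := fe N y y0.
rewrite !ler_norml !ltr_norml => /andP[a1 a2] /andP[a3 a4] /andP[a5 a6].
by apply/andP; split; lra.
Qed.

(** Telescoping and summing the geometric series bounds the distance from
    [u n] to every later term. *)
Lemma geometric_decrease (u : nat -> R) (c k : R) :
  0 < k < 1 -> 0 <= c -> (forall n, u n.+1 <= u n) ->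
  (forall n, u n - u n.+1 <= c * k ^+ n.+1) ->
  exists2 l, u n @[n --> \oo] --> l &
    forall n, 0 <= u n - l <= c / (1 - k) * k ^+ n.+1.
Proof.
move=> /andP[k0 k1] c0 ud uc.
have k10 : 0 < 1 - k by lra.
have ui : {homo u : n m / (n <= m)%N >-> m <= n} by apply/nonincreasing_seqP.
have dist n m : u n - u (n + m)%N <= c / (1 - k) * k ^+ n.+1.
  apply: (@le_trans _ _ (c / (1 - k) * k ^+ n.+1 * (1 - k ^+ m))).
    elim: m => [|m IH]; first by rewrite addn0 expr0 !subrr mulr0.
    have := uc (n + m)%N; rewrite addnS.
    have -> : c * k ^+ (n + m).+1 =
      c / (1 - k) * k ^+ n.+1 * (k ^+ m - k ^+ m.+1).
      by rewrite -addSn exprD (exprS _ m); field; rewrite gt_eqF.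
    by move: IH; lra.
  rewrite ler_piMr //; last by rewrite lerBlDr lerDl exprn_ge0 // ltW.
  by rewrite mulr_ge0 ?exprn_ge0 ?divr_ge0 // ltW.
have lb : has_lbound (range u).
  exists (u 0%N - c / (1 - k) * k ^+ 1) => _ [n _ <-].
  by have := dist 0%N n; rewrite add0n; lra.
have ul := nonincreasing_cvgn ui lb.
exists (inf (range u)) => // n.
have iu : inf (range u) <= u n by apply: ge_inf => //; exists n.
rewrite subr_ge0 iu /= lerBlDr -lerBlDl.
apply: lb_le_inf; first by exists (u 0%N); exists 0%N.
move=> _ [m _ <-]; have [nm|/ltnW mn] := leqP n m.
  by have := dist n (m - n)%N; rewrite subnKC//; lra.
by have := dist n 0%N; have := ui _ _ mn; rewrite addn0; lra.
Qed.

End limits.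

(** * The kernel and its integrable majorant *)

Section kernel.
Context {R : realType} (K mu : R -> R).
Local Notation lam := (@lebesgue_measure R).
Implicit Types (f g : R -> R) (a c k m p r s t u v w x A L M : R).
Hypothesis K_gt0 : forall x, 0 < K x.
Hypothesis K_even : forall t, 0 <= t -> K (- t) = K t.
Hypothesis K_derivable : forall x, derivable K x 1.
Hypothesis K_decr : decreasing_on Rplus K.
Hypothesis K_mass : (\int[lam]_(t in Rplus) (K t)%:E = (2^-1 : R)%:E)%E.
Hypothesis mu_gt0 : forall t, 0 <= t -> 0 < mu t.
Hypothesis mu_summable : lam.-integrable Rplus (EFin \o mu).

Lemma continuous_kernel : continuous K.
Proof.
move=> x; apply: differentiable_continuous; apply/derivable1_diffP.
exact: K_derivable.
Qed.

Lemma kernel_norm x : K `|x| = K x.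
Proof.
have [x0|x0] := leP 0 x; first by rewrite ger0_norm.
by rewrite ltr0_norm // -{2}(opprK x) [RHS]K_even // oppr_ge0 ltW.
Qed.

Lemma kernel_le x y : `|x| <= `|y| -> K y <= K x.
Proof.
rewrite -(kernel_norm x) -(kernel_norm y) le_eqVlt => /predU1P[-> //|xy].
by apply/ltW/K_decr => //; rewrite in_Rplus.
Qed.

Lemma kernel_distC x y : K (x - y) = K (y - x).
Proof. by rewrite -kernel_norm distrC kernel_norm. Qed.

Lemma odd_kernel_ge0 x t : 0 <= x -> 0 <= t -> 0 <= K (x - t) - K (x + t).
Proof.
move=> x0 t0; rewrite subr_ge0; apply: kernel_le.
by rewrite (ger0_norm (addr_ge0 x0 t0)) ler_norml; apply/andP; split; lra.
Qed.

(** The values [K (x - t)] and [K (x + t)] for [`|x| <= a] involve points at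
    distance at least [t - a] from [0]; the kernel being decreasing, its
    value at that distance dominates them all. *)
Definition kernel_majorant (a t : R) : R := K (Num.max (t - a) 0).

Lemma kernel_majorant_ge0 a t : 0 <= kernel_majorant a t.
Proof. exact/ltW/K_gt0. Qed.

Lemma kernel_majorantB a x t : `|x| <= a -> 0 <= t ->
  K (x - t) <= kernel_majorant a t.
Proof.
rewrite ler_norml => /andP[xa ax] t0; apply: kernel_le.
rewrite ger0_norm; last by rewrite le_max lexx orbT.
rewrite ge_max normr_ge0 andbT distrC ler_normr.
by apply/orP; left; lra.
Qed.

Lemma kernel_majorantD a x t : `|x| <= a -> 0 <= t ->
  K (x + t) <= kernel_majorant a t.
Proof.
move=> xa t0; rewrite -kernel_norm -normrN kernel_norm opprD.
by apply: kernel_majorantB; rewrite ?normrN.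
Qed.

Lemma continuous_kernel_majorant a : continuous (kernel_majorant a).
Proof.
move=> t; apply: (@continuous_comp _ _ _ (fun t => Num.max (t - a) 0) K).
  apply: (@continuous_max _ _ (fun t => t - a) (fun=> 0)).
    by apply: cvgB; [exact: cvg_id|exact: cvg_cst].
  exact: cvg_cst.
exact: continuous_kernel.
Qed.

Lemma kernel_shift_mass a :
  (\int[lam]_(t in `[a, +oo[) (K (t - a))%:E = (2^-1 : R)%:E)%E.
Proof.
rewrite -K_mass /Rplus.
have D : (fun t => t + a)^`()%classic = cst 1 :> (R -> R).
  by apply/funext => t; rewrite derive1E deriveD // derive_id derive_cst addr0.
have := @increasing_ge0_integration_by_substitutiony R (fun t => t + a)
  (fun t => K (t - a)) 0.
rewrite add0r D => ->.
- by apply: eq_integral => t _ /=; rewrite mulr1 /= addrK.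
- by move=> x y _ _ xy; rewrite ltrD2r.
- by move=> x _; exact: cvg_cst.
- exact: is_cvg_cst.
- exact: is_cvg_cst.
- split; first by move=> x _; exact: derivableD.
  apply: cvg_at_right_filter; apply: cvgD; [exact: cvg_id|exact: cvg_cst].
- exact: cvg_addrr.
- apply: continuous_subspaceT => x; apply: continuous_comp.
    by apply: cvgB; [exact: cvg_id|exact: cvg_cst].
  exact: continuous_kernel.
- by move=> x _; exact/ltW/K_gt0.
Qed.

(** The majorant is constant up to [a] and a translate of [K] beyond. *)
Lemma integrable_kernel_majorant a : 0 <= a ->
  lam.-integrable Rplus (EFin \o kernel_majorant a).
Proof.
move=> a0.
have mH (A : set R) : measurable A -> measurable_fun A (kernel_majorant a).
  move=> mA; apply: measurable_funTS.
  apply: continuous_measurable_fun.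
  exact: continuous_kernel_majorant.
have E : (Rplus : set R) = `[0, a[ `|` `[a, +oo[.
  apply/seteqP; split=> t; rewrite RplusE /= !in_itv /= andbT.
    by move=> t0; have [ta|ta] := ltP t a; [left; rewrite t0|right].
  by case=> [/andP[]//|]; apply: le_trans.
apply/integrableP; split.
  by apply/measurable_EFinP; apply: mH; exact: measurable_Rplus.
rewrite E ge0_integral_setU //=.
- apply: lte_add_pinfty.
    have /integrableP[//] : lam.-integrable `[0, a[ (EFin \o kernel_majorant a).
    apply: measurable_bounded_integrable; first exact: measurable_itv.
    + rewrite [X in (X < _)%E]lebesgue_measure_itv /= lte_fin.
      by case: ifP => // _; rewrite ltry.
    + apply: mH; exact: measurable_itv.
    + apply/bounded_onP; exists (K 0) => t _.
      rewrite ger0_norm ?kernel_majorant_ge0//; apply: kernel_le.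
      by rewrite normr0.
  apply: (@le_lt_trans _ _ (2^-1)%:E); last by rewrite ltry.
  rewrite -(kernel_shift_mass a) le_eqVlt; apply/orP; left.
  apply/eqP/eq_integral => t.
  rewrite inE /= in_itv /= andbT => at_.
  rewrite ger0_norm ?kernel_majorant_ge0// /kernel_majorant max_l //.
  by rewrite subr_ge0.
- rewrite -E; apply/measurable_EFinP; apply: measurableT_comp => //.
  apply: mH; exact: measurable_Rplus.
- apply/disj_setPS => t [] /=; rewrite !in_itv /= andbT => /andP[_ ta].
  by rewrite leNgt ta.
Qed.

(** * Convolution of dominated functions *)

(** A class containing the sources of all three equations, stable under the
    operations performed on them, on which the convolution is finite. *)
Definition dominated (f : R -> R) : Prop :=
  measurable_fun Rplus f /\
  exists A, forall t, 0 <= t -> `|f t| <= A * (1 + mu t).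

Lemma measurable_weight : measurable_fun Rplus mu.
Proof. by apply/measurable_EFinP; exact: measurable_int mu_summable. Qed.

Lemma dominatedD f g : dominated f -> dominated g ->
  dominated (fun t => f t + g t).
Proof.
move=> [mf [A fA]] [mg [B gB]]; split; first exact: measurable_funD.
exists (A + B) => t t0; rewrite mulrDl (le_trans (ler_normD _ _))//.
by rewrite lerD // ?fA ?gB.
Qed.

Lemma dominatedZ c f : dominated f -> dominated (fun t => c * f t).
Proof.
move=> [mf [A fA]]; split.
  by apply: measurable_funM => //; exact: measurable_cst.
exists (`|c| * A) => t t0; rewrite normrM -mulrA ler_wpM2l//; exact: fA.
Qed.

Lemma dominated_bounded f M : measurable_fun Rplus f ->
  (forall t, 0 <= t -> `|f t| <= M) -> dominated f.
Proof.
move=> mf fM; split=> //; exists M => t t0; rewrite (le_trans (fM t t0))//.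
rewrite ler_peMr ?(le_trans (normr_ge0 _) (fM t t0))//.
by rewrite lerDl ltW // mu_gt0.
Qed.

Lemma dominated_weight f M : measurable_fun Rplus f ->
  (forall t, 0 <= t -> `|f t| <= M) -> dominated (fun t => mu t * f t).
Proof.
move=> mf fM; split.
  by apply: measurable_funM => //; exact: measurable_weight.
exists M => t t0; have := mu_gt0 t0; have := fM t t0; have := normr_ge0 (f t).
rewrite normrM (ger0_norm (ltW (mu_gt0 t0))).
nra.
Qed.

Lemma dominated_le f g : measurable_fun Rplus f -> dominated g ->
  (forall t, 0 <= t -> `|f t| <= `|g t|) -> dominated f.
Proof.
move=> mf [_ [A gA]] fg; split=> //; exists A => t t0.
exact: le_trans (fg t t0) (gA t t0).
Qed.

Local Notation H := kernel_majorant.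

Lemma integrable_majorant_weight a : 0 <= a ->
  lam.-integrable Rplus (EFin \o (fun t => H a t * (1 + mu t))).
Proof.
move=> a0.
have mH : measurable_fun Rplus (H a).
  apply: measurable_funTS; apply: continuous_measurable_fun.
  exact: continuous_kernel_majorant.
have iH : lam.-integrable Rplus (EFin \o H a).
  exact: integrable_kernel_majorant.
have bH : [bounded H a t | t in Rplus].
  apply/bounded_onP; exists (K 0) => t _.
  rewrite ger0_norm; last exact: kernel_majorant_ge0.
  by apply: kernel_le; rewrite normr0.
have iHmu := integrableMr measurable_Rplus mH bH mu_summable.
apply: eq_integrable (integrableD measurable_Rplus iH iHmu).
  exact: measurable_Rplus.
by move=> t _ /=; rewrite mulrDr mulr1 EFinD.
Qed.

Lemma odd_kernel_le a x t : `|x| <= a -> 0 <= t ->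
  `|K (x - t) - K (x + t)| <= H a t.
Proof.
move=> xa t0.
have := kernel_majorantB xa t0.
have := kernel_majorantD xa t0.
have := K_gt0 (x - t); have := K_gt0 (x + t).
rewrite ler_norml => *; apply/andP; split; lra.
Qed.

Lemma odd_kernel_weight_le f A a x t :
  (forall t, 0 <= t -> `|f t| <= A * (1 + mu t)) -> `|x| <= a -> 0 <= t ->
  `|(K (x - t) - K (x + t)) * f t| <= A * (H a t * (1 + mu t)).
Proof.
move=> fA xa t0; rewrite normrM mulrCA; apply: ler_pM => //; last exact: fA.
exact: odd_kernel_le.
Qed.

Lemma measurable_odd_kernel x :
  measurable_fun Rplus (fun t => K (x - t) - K (x + t)).
Proof.
have cK := continuous_kernel.
apply: measurable_funTS; apply: continuous_measurable_fun => t.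
apply: cvgB.
  apply: continuous_comp; last exact: cK.
  by apply: cvgB; [exact: cvg_cst|exact: cvg_id].
apply: continuous_comp; last exact: cK.
by apply: cvgD; [exact: cvg_cst|exact: cvg_id].
Qed.

Lemma integrable_odd_convolution f x : dominated f ->
  lam.-integrable Rplus (EFin \o (fun t => (K (x - t) - K (x + t)) * f t)).
Proof.
move=> [mf [A fA]].
have i := integrableZl measurable_Rplus A
  (integrable_majorant_weight (normr_ge0 x)).
apply: (le_integrable measurable_Rplus _ _ i).
  apply/measurable_EFinP/measurable_funM => //; exact: measurable_odd_kernel.
move=> t; rewrite RplusE => t0 /=; rewrite lee_fin.
by rewrite (le_trans (odd_kernel_weight_le fA (lexx _) t0)) // ler_norm.
Qed.

Lemma odd_convolutionD f g x : dominated f -> dominated g ->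
  odd_convolution K (fun t => f t + g t) x =
  odd_convolution K f x + odd_convolution K g x.
Proof.
move=> df dg; rewrite /odd_convolution -RintegralD; last 3 first.
- exact: measurable_Rplus.
- exact: integrable_odd_convolution.
- exact: integrable_odd_convolution.
by apply: eq_Rintegral => t _; rewrite mulrDr.
Qed.

Lemma odd_convolutionZ c f x : dominated f ->
  odd_convolution K (fun t => c * f t) x = c * odd_convolution K f x.
Proof.
move=> df; rewrite /odd_convolution -RintegralZl; last 2 first.
- exact: measurable_Rplus.
- exact: integrable_odd_convolution.
by apply: eq_Rintegral => t _; rewrite mulrCA.
Qed.

Lemma le_odd_convolution f g x : 0 <= x -> dominated f -> dominated g ->
  (forall t, 0 <= t -> f t <= g t) ->
  odd_convolution K f x <= odd_convolution K g x.
Proof.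
move=> x0 df dg fg; apply: le_Rintegral.
- exact: measurable_Rplus.
- exact: integrable_odd_convolution.
- exact: integrable_odd_convolution.
move=> t; rewrite RplusE => t0; apply: ler_wpM2l; last exact: fg.
exact: odd_kernel_ge0.
Qed.

Lemma odd_convolution_at0 f : odd_convolution K f 0 = 0.
Proof.
rewrite /odd_convolution; under eq_Rintegral => t.
  rewrite in_Rplus => t0.
  rewrite sub0r add0r K_even // subrr mul0r; over.
by rewrite Rintegral_cst ?mul0r //; exact: measurable_Rplus.
Qed.

(** Dominated convergence, with one majorant for all points of the interval
    of radius [`|x| + 1] around [0]. *)
Lemma continuous_odd_convolution f : dominated f ->
  continuous (odd_convolution K f).
Proof.
move=> [mf [A fA]] x; set a := `|x| + 1.
have a0 : 0 <= a by rewrite addr_ge0.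
have cK := continuous_kernel.
apply: (@continuity_under_integral _ _ _ lam
  (fun x t => (K (x - t) - K (x + t)) * f t) _ measurable_Rplus (- a) a _ _
  (fun t => A * (H a t * (1 + mu t)))).
- by move=> y _; apply: integrable_odd_convolution; split=> //; exists A.
- apply: aeW => t _ y _; apply: cvgM; last exact: cvg_cst.
  apply: cvgB.
    apply: continuous_comp; last exact: cK.
    by apply: cvgB; [exact: cvg_id|exact: cvg_cst].
  apply: continuous_comp; last exact: cK.
  by apply: cvgD; [exact: cvg_id|exact: cvg_cst].
- exact: (integrableZl measurable_Rplus A (integrable_majorant_weight a0)).
- move=> y; rewrite /= in_itv /= => ya; apply: aeW => t; rewrite RplusE => t0.
  by apply: odd_kernel_weight_le => //; rewrite ltW // ltr_norml.
- rewrite inE /= in_itv /= -ltr_norml /a; lra.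
Qed.

(** * First-order behaviour at the origin *)

Lemma kernel_MVT a b : a <= b ->
  exists2 c, c \in `[a, b] & K b - K a = derive1 K c * (b - a).
Proof.
move=> ab; apply: MVT_segment => //.
- move=> x _; rewrite derive1E; apply: DeriveDef => //; exact: K_derivable.
- by apply: continuous_subspaceT; exact: continuous_kernel.
Qed.

Lemma odd_kernel_upper : [bounded derive1 K x | x in setT] ->
  exists2 L, 0 <= L &
  forall x t, 0 <= x -> K (x - t) - K (x + t) <= L * x.
Proof.
move=> /bounded_onP[M dKM]; exists (2 * M).
  by rewrite mulr_ge0 // (le_trans (normr_ge0 _) (dKM 0 I)).
move=> x t x0.
rewrite kernel_distC.
have tx : t - x <= x + t by lra.
have [c _ Kc] := kernel_MVT tx.
have := dKM c I; rewrite ler_norml => /andP[Mc _].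
have := ler_wpM2r x0 Mc; lra.
Qed.

(** [K] decreases from [1] to [2], so [K'] is negative somewhere in between,
    hence on a neighbourhood, where the mean value theorem bounds the
    difference from below. *)
Lemma odd_kernel_lower : continuous (derive1 K) ->
  exists p r c, [/\ 0 < p, 0 < r, 0 < c &
    forall x t, 0 <= x <= r -> p <= t <= p + r ->
      c * x <= K (x - t) - K (x + t)].
Proof.
move=> cdK.
have [q] := kernel_MVT (ler_nat _ 1 2 : (1 : R) <= 2).
rewrite in_itv /= => /andP[q1 q2] Kq.
have dq : derive1 K q < 0.
  have : K 2 < K 1.
    by apply: K_decr; rewrite ?in_Rplus ?ler01 ?ler0n ?ltr1n.
  lra.
have d2 : 0 < - derive1 K q / 2 by lra.
have /cvgrPdist_lt /(_ _ d2)/nbhs_ballP[r r0 Hr] := cdK q.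
(* with x <= s and q <= t <= q + s, the points t - x and x + t stay within
   2 s < r of q *)
pose s : R := r / 3.
have s0 : 0 < s by rewrite divr_gt0.
exists q, s, (- derive1 K q); split; [lra|by []|lra|].
move=> x t /andP[x0 xs] /andP[qt ts].
rewrite kernel_distC.
have tx : t - x <= x + t by lra.
have [c] := kernel_MVT tx; rewrite in_itv /= => /andP[c1 c2] Kc.
have /Hr : ball q r c.
  rewrite /ball /= ltr_norml; move: xs ts s0; rewrite /s => xs ts s0.
  by apply/andP; split; lra.
rewrite /= ltr_norml => /andP[h1 _].
have dc : derive1 K c <= derive1 K q / 2 by lra.
have := ler_wpM2r x0 dc; lra.
Qed.

(** Only the part of the integral over [p, p + r] is kept. *)
Lemma odd_convolution_lower f m p r c :
  dominated f ->
  (forall t, 0 <= t -> 0 <= f t) -> (forall t, p <= t -> m <= f t) ->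
  0 <= m -> 0 < p -> 0 < r -> 0 < c ->
  (forall x t, 0 <= x <= r -> p <= t <= p + r ->
      c * x <= K (x - t) - K (x + t)) ->
  forall x, 0 <= x <= r -> c * m * r * x <= odd_convolution K f x.
Proof.
move=>  df f0 fm m0 p0 r0 c0 Kc x xr.
have /andP[x0 _] := xr.
pose I : set R := `[p, p + r]%classic.
pose v := c * x * m.
have v0 : 0 <= v by rewrite !mulr_ge0 // ltW.
have IR : Rplus `&` I = I.
  apply/setIidr => t; rewrite RplusE /I /= in_itv /= => /andP[pt _].
  exact: le_trans (ltW p0) pt.
have -> : c * m * r * x = \int[lam]_(t in Rplus) ((fun=> v) \_ I) t.
  rewrite -Rintegral_mkcondr IR Rintegral_cst; last exact: measurable_itv.
  rewrite [X in fine X]lebesgue_measure_itv /= lte_fin ltrDl r0 /=.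
  by rewrite /v addrAC subrr add0r; ring.
apply: le_Rintegral.
- exact: measurable_Rplus.
- have -> : EFin \o (fun=> v) \_ I = (EFin \o (fun=> v)) \_ I.
    by rewrite restrict_EFin.
  have mI : measurable (I : set (measurableTypeR R)) by exact: measurable_itv.
  apply: (proj1 (integrable_restrict lam mI measurable_Rplus _)).
  rewrite IR; apply: measurable_bounded_integrable.
  + exact: measurable_itv.
  + rewrite [X in (X < _)%E]lebesgue_measure_itv /=; case: ifP => // _.
    by rewrite ltry.
  + exact: measurable_cst.
  + by apply/bounded_onP; exists `|v|.
- exact: integrable_odd_convolution.
move=> t; rewrite RplusE => t0; rewrite patchE; case: ifPn => tI.
  have /andP[pt tr] : p <= t <= p + r by move: tI; rewrite inE /I /= in_itv.
  apply: ler_pM => //; [by rewrite mulr_ge0 // ltW| |exact: fm].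
  by apply: Kc => //; rewrite pt.
by rewrite mulr_ge0 ?f0 // odd_kernel_ge0.
Qed.

Lemma odd_convolution_weight_upper f M L :
  measurable_fun Rplus f -> (forall t, 0 <= t -> 0 <= f t <= M) ->
  0 <= L -> (forall x t, 0 <= x -> K (x - t) - K (x + t) <= L * x) ->
  forall x, 0 <= x -> odd_convolution K (fun t => mu t * f t) x <=
    L * M * (\int[lam]_(t in Rplus) mu t) * x.
Proof.
move=>  mf fM L0 KL x x0.
have -> : L * M * (\int[lam]_(t in Rplus) mu t) * x =
  \int[lam]_(t in Rplus) (L * M * x * mu t).
  by rewrite RintegralZl //; [ring|exact: measurable_Rplus].
apply: le_Rintegral.
- exact: measurable_Rplus.
- apply: integrable_odd_convolution.
  apply: (dominated_weight (M := M)) => // t t0.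
  by have /andP[f0 f1] := fM t t0; rewrite ger0_norm.
- exact: (integrableZl measurable_Rplus (L * M * x) mu_summable).
move=> t; rewrite RplusE => t0; have /andP[f0 f1] := fM t t0.
have -> : L * M * x * mu t = (L * x) * (mu t * M) by ring.
apply: ler_pM; [exact: odd_kernel_ge0| |exact: KL|].
  by rewrite mulr_ge0 // ltW // mu_gt0.
by rewrite ler_wpM2l // ltW // mu_gt0.
Qed.


(** * The nonlinear operator *)

Section superposition.
Variable omega2 : R -> R -> R.
Hypothesis omega2_0 : forall t, 0 <= t -> omega2 t 0 = 0.
Hypothesis omega2_continuous :
  {within Rplus `*` Rplus, continuous (fun p : R * R => omega2 p.1 p.2)}.
Hypothesis omega2_incr : forall t, 0 <= t -> increasing_on Rplus (omega2 t).
Hypothesis omega2_concave : forall t, 0 <= t -> concave_on Rplus (omega2 t).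
Hypothesis omega2_le :
  forall t u, 0 <= t -> 0 <= u -> omega2 t u <= mu t * u.

Lemma le_omega2 t u v : 0 <= t -> 0 <= u <= v -> omega2 t u <= omega2 t v.
Proof.
move=> t0 /andP[u0]; rewrite le_eqVlt => /predU1P[-> //|uv].
by apply/ltW/omega2_incr; rewrite ?in_Rplus // (le_trans u0 (ltW uv)).
Qed.

Lemma omega2_ge0 t u : 0 <= t -> 0 <= u -> 0 <= omega2 t u.
Proof.
by move=> t0 u0; rewrite -(omega2_0 t0) le_omega2 // lexx.
Qed.

Lemma continuous_superposition f : {within Rplus, continuous f} ->
  (forall t, 0 <= t -> 0 <= f t) ->
  {within Rplus, continuous (fun t => omega2 t (f t))}.
Proof.
move=> /subspace_continuousP cf f0; apply/subspace_continuousP => t tR.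
have t0 : 0 <= t by move: tR; rewrite RplusE.
have ftR : (Rplus `*` Rplus) (t, f t) by split => //; rewrite RplusE /= f0.
move: omega2_continuous => /subspace_continuousP /(_ _ ftR) cw.
have tf : (fun s => (s, f s)) @ within Rplus (nbhs t) --> nbhs (t, f t).
  have tt : s @[s --> within Rplus (nbhs t)] --> t by exact: cvg_within.
  exact: (cvg_pair tt (cf t tR)).
have tw : (fun s => (s, f s)) @ within Rplus (nbhs t) -->
    within (Rplus `*` Rplus) (nbhs (t, f t)).
  move=> U /tf; apply: (@filterS _ (nbhs t)) => s Hs sR.
  apply: Hs => //; split=> //.
  by rewrite RplusE /= f0 //; move: sR; rewrite RplusE.
exact: (cvg_comp _ _ tw cw).
Qed.

Variable xi : R.

Definition admissible f : Prop :=
  {within Rplus, continuous f} /\ forall t, 0 <= t -> 0 <= f t <= xi.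

Lemma dominated_source f : admissible f ->
  dominated (fun t => f t + omega2 t (f t)).
Proof.
move=> [cf fxi].
have f0 t : 0 <= t -> 0 <= f t by move=> /fxi/andP[].
apply: dominatedD.
  apply: (dominated_bounded (M := xi)); first exact: measurable_fun_Rplus.
  by move=> t t0; rewrite ger0_norm ?f0 //; have /andP[] := fxi t t0.
apply: (dominated_le (g := fun t => mu t * xi)).
- by apply: measurable_fun_Rplus; exact: continuous_superposition.
- by apply: (dominated_weight (M := `|xi|)) => //; exact: measurable_cst.
- move=> t t0; rewrite ger0_norm ?omega2_ge0 ?f0 //.
  apply: le_trans (ler_norm _); apply: (le_trans (omega2_le t0 (f0 t t0))).
  by apply: ler_wpM2l; [exact/ltW/mu_gt0|have /andP[] := fxi t t0].
Qed.

(** Concavity of [omega2 t] makes the nonlinear operator superhomogeneous.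
    With [s = 1] this is its monotonicity. *)
Lemma op_B_scale s f g x : 0 <= s <= 1 -> admissible f -> admissible g ->
  (forall t, 0 <= t -> s * f t <= g t) -> 0 <= x ->
  s * op_B K omega2 f x <= op_B K omega2 g x.
Proof.
move=> s01 af ag fg x0; have /andP[s0 _] := s01.
rewrite /op_B -odd_convolutionZ; last exact: dominated_source.
apply: le_odd_convolution => //.
- by apply: dominatedZ; exact: dominated_source.
- exact: dominated_source.
move=> t t0; have /andP[ft0 _] := af.2 t t0.
rewrite mulrDr lerD ?fg //.
have := concave_star (omega2_concave t0) (omega2_0 t0) s01 ft0.
by move=> /le_trans; apply; rewrite le_omega2 // mulr_ge0 //= fg.
Qed.

Lemma le_op_B f g x : admissible f -> admissible g ->
  (forall t, 0 <= t -> f t <= g t) -> 0 <= x ->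
  op_B K omega2 f x <= op_B K omega2 g x.
Proof.
move=> af ag fg x0; rewrite -[leLHS]mul1r.
by apply: op_B_scale => //; [rewrite ler01 lexx|move=> t /fg; rewrite mul1r].
Qed.

(** [omega2 t] is Lipschitz with constant [mu t]. *)
Lemma op_B_lipschitz f g e x : admissible f -> admissible g ->
  (forall t, 0 <= t -> 0 <= f t - g t <= e) -> 0 <= x ->
  op_B K omega2 f x - op_B K omega2 g x <=
  e * odd_convolution K (fun t => 1 + mu t) x.
Proof.
move=> af ag fg x0.
have d1 : dominated (fun t => 1 + mu t).
  split.
    by apply: measurable_funD; [exact: measurable_cst|exact: measurable_weight].
  by exists 1 => t t0; rewrite mul1r ger0_norm // addr_ge0 // ltW // mu_gt0.
have ds := dominated_source ag; have de := dominatedZ e d1.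
rewrite lerBlDl -odd_convolutionZ // -odd_convolutionD //.
apply: le_odd_convolution => //; [exact: dominated_source|exact: dominatedD|].
move=> t t0; have /andP[g0 _] := ag.2 t t0; have /andP[fg0 fge] := fg t t0.
have gf : 0 <= g t <= f t by rewrite g0 -subr_ge0.
have := concave_lipschitz (omega2_concave t0) (omega2_0 t0)
  (fun w => @omega2_le t w t0) gf.
have := ler_wpM2l (ltW (mu_gt0 t0)) fge; lra.
Qed.

Lemma continuous_op_B f : admissible f ->
  {within Rplus, continuous (op_B K omega2 f)}.
Proof.
move=> af; apply: continuous_subspaceT.
by apply: continuous_odd_convolution; exact: dominated_source.
Qed.

Lemma dominated_weighted f : admissible f ->
  dominated (fun t => (1 + mu t) * f t).
Proof.
move=> [cf fxi].
have mf := measurable_fun_Rplus cf.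
have fM t : 0 <= t -> `|f t| <= xi.
  by move=> /fxi /andP[f0 f1]; rewrite ger0_norm.
have := dominatedD (dominated_bounded mf fM) (dominated_weight mf fM).
by congr dominated; apply/funext => t; rewrite mulrDl mul1r.
Qed.

Lemma op_B_le_op_Phi f g x : admissible f -> admissible g ->
  (forall t, 0 <= t -> f t <= g t) -> 0 <= x ->
  op_B K omega2 f x <= op_Phi K mu g x.
Proof.
move=> af ag fg x0; apply: (le_trans (le_op_B af ag fg x0)).
apply: le_odd_convolution => //.
- exact: dominated_source.
- exact: dominated_weighted.
move=> t t0; have /andP[g0 _] := ag.2 t t0.
by rewrite mulrDl mul1r lerD2l omega2_le.
Qed.

Lemma op_F_le_op_B f g x : admissible f -> admissible g ->
  (forall t, 0 <= t -> f t <= g t) -> 0 <= x ->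
  op_F K f x <= op_B K omega2 g x.
Proof.
move=> [cf fxi] ag fg x0; apply: le_odd_convolution => //; last 2 first.
- exact: dominated_source.
- move=> t t0; have /andP[g0 _] := ag.2 t t0.
  by rewrite (le_trans (fg t t0)) // lerDl omega2_ge0.
apply: (dominated_bounded (M := xi)); first exact: measurable_fun_Rplus.
by move=> t /fxi /andP[f0 f1]; rewrite ger0_norm.
Qed.

(** With [T f x >= b x] and [T (mu f) x <= d x], the weighted convolution
    [T f x + T (mu f) x] is at most [(1 + d / b) T f x]. *)
Lemma op_B_ge_op_Phi_near0 f : admissible f -> continuous (derive1 K) ->
  [bounded derive1 K x | x in setT] ->
  (forall p, 0 < p -> exists2 m, 0 < m & forall t, p <= t -> m <= f t) ->
  exists r s, [/\ 0 < r, 0 < s & forall x, 0 <= x <= r ->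
    s * op_Phi K mu f x <= op_B K omega2 f x].
Proof.
move=> af cdK bdK fpos; have [cf fxi] := af.
have mf := measurable_fun_Rplus cf.
have f0 t : 0 <= t -> 0 <= f t by move=> /fxi/andP[].
have fM t : 0 <= t -> `|f t| <= xi.
  by move=> t0; rewrite ger0_norm ?f0 //; have /andP[] := fxi t t0.
have df := dominated_bounded mf fM; have dwf := dominated_weight mf fM.
have [p [r [c [p_gt0 r_gt0 c_gt0 Kc]]]] := odd_kernel_lower cdK.
have [m m_gt0 fm] := fpos p p_gt0.
have [L L_ge0 KL] := odd_kernel_upper bdK.
have lo := odd_convolution_lower df f0 fm (ltW m_gt0) p_gt0 r_gt0 c_gt0 Kc.
have hi := odd_convolution_weight_upper mf fxi L_ge0 KL.
pose b := c * m * r.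
have b0 : 0 < b by rewrite !mulr_gt0.
pose d := L * xi * \int[lam]_(t in Rplus) mu t.
have d0 : 0 <= d.
  rewrite mulr_ge0 //; last first.
    by apply: Rintegral_ge0 => t; rewrite RplusE => /mu_gt0/ltW.
  rewrite mulr_ge0 // (le_trans (f0 0 (lexx _))) //.
  by rewrite (le_trans (ler_norm _) (fM 0 _)).
exists r, (b / (b + d)); split => //; first by rewrite divr_gt0 // ltr_wpDr.
move=> x xr; have /andP[x0 _] := xr.
have E : op_Phi K mu f x =
    odd_convolution K f x + odd_convolution K (fun t => mu t * f t) x.
  rewrite -odd_convolutionD //; congr (odd_convolution K _ x).
  by apply/funext => t; rewrite mulrDl mul1r.
have {}lo : b * x <= odd_convolution K f x by exact: lo.
have {}hi := hi x x0; rewrite -/d in hi.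
have le1 : odd_convolution K f x <= op_B K omega2 f x.
  exact: (@op_F_le_op_B f f x af af).
apply: le_trans le1.
rewrite mulrAC ler_pdivrMr; last by rewrite ltr_wpDr.
rewrite E mulrDr [leRHS]mulrC mulrDl lerD2l.
apply: (@le_trans _ _ (b * (d * x))); first by rewrite ler_wpM2l // ltW.
by rewrite mulrCA ler_wpM2l.
Qed.

(** * The successive approximations *)

Section iteration.
Variables (Q F Phi : R -> R) (B_ : nat -> R -> R).
Hypothesis Q_incr : increasing_on Rplus Q.
Hypothesis Q_continuous : {within Rplus, continuous Q}.
Hypothesis Q_0 : Q 0 = 0.
Hypothesis F_admissible : admissible F.
Hypothesis F_nondecr : {in Rplus &, {homo F : x y / x <= y}}.
Hypothesis F_gt0 : forall x, 0 < x -> 0 < F x.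
Hypothesis F_eq : forall x, 0 <= x -> Q (F x) = op_F K F x.
Hypothesis Phi_admissible : admissible Phi.
Hypothesis Phi_0 : Phi 0 = 0.
Hypothesis Phi_bounds : forall x, 0 < x -> F x < Phi x < xi.
Hypothesis Phi_eq : forall x, 0 <= x -> Q (Phi x) = op_Phi K mu Phi x.
Hypothesis B_approx : successive_approximations Q (op_B K omega2) Phi B_.

Lemma F_ge0 x : 0 <= x -> 0 <= F x.
Proof. by move=> /F_admissible.2 /andP[]. Qed.

Lemma Q_le_inv u v : 0 <= u -> 0 <= v -> Q u <= Q v -> u <= v.
Proof. by move=> u0 v0; rewrite (increasing_le_mono Q_incr) ?in_Rplus. Qed.

Lemma Q_homo u v : 0 <= u -> u <= v -> Q u <= Q v.
Proof.
move=> u0 uv; rewrite (increasing_le_mono Q_incr) ?in_Rplus //.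
exact: le_trans uv.
Qed.

(** At [0] the equation for [F] forces [F 0 = 0]. *)
Lemma F_le_Phi x : 0 <= x -> F x <= Phi x.
Proof.
rewrite le_eqVlt => /predU1P[<-|/Phi_bounds/andP[/ltW]//].
apply: Q_le_inv; rewrite ?F_ge0 ?Phi_0 //.
by rewrite F_eq // Q_0 /op_F odd_convolution_at0.
Qed.

Lemma between_admissible f : {within Rplus, continuous f} ->
  (forall x, 0 <= x -> F x <= f x <= Phi x) -> admissible f.
Proof.
move=> cf FfPhi; split=> // x x0; have /andP[Ff fPhi] := FfPhi x x0.
rewrite (le_trans (F_ge0 x0) Ff) (le_trans fPhi) //.
by have /andP[] := Phi_admissible.2 x x0.
Qed.

(** Continuity has to be part of the induction: it makes the source of the
    next integral measurable. *)
Lemma B_between n : {within Rplus, continuous (B_ n)} /\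
  forall x, 0 <= x -> F x <= B_ n x <= Phi x.
Proof.
have [B0 Bge0 BS] := B_approx.
elim: n => [|n [cB FBPhi]].
  split=> [|x x0]; last by rewrite B0 // lexx F_le_Phi.
  have /continuous_RplusP cPhi := Phi_admissible.1.
  apply/continuous_RplusP => x x0 e e0; have [d d0 Hd] := cPhi x x0 e e0.
  by exists d => // y y0 xy; rewrite !B0 // Hd.
have aB := between_admissible cB FBPhi.
split.
  apply: (continuous_of_increasing_comp Q_incr); first exact: Bge0.
  have /continuous_RplusP cT := continuous_op_B aB.
  apply/continuous_RplusP => x x0 e e0; have [d d0 Hd] := cT x x0 e e0.
  by exists d => // y y0 xy; rewrite /= !BS // Hd.
move=> x x0; apply/andP; split.
  apply: Q_le_inv; rewrite ?F_ge0 ?Bge0 // BS // F_eq //.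
  by apply: op_F_le_op_B => // t /FBPhi /andP[].
apply: Q_le_inv; [exact: Bge0|by have /andP[] := Phi_admissible.2 x x0|].
rewrite BS // Phi_eq //.
by apply: op_B_le_op_Phi => // t /FBPhi /andP[].
Qed.

Lemma B_admissible n : admissible (B_ n).
Proof. have [cB FBPhi] := B_between n; exact: between_admissible. Qed.

Lemma B_ge0 n x : 0 <= x -> 0 <= B_ n x.
Proof. by have [_ + _] := B_approx; apply. Qed.

Lemma B_at0 n : B_ n 0 = 0.
Proof.
have /andP[_] := (B_between n).2 0 (lexx _); rewrite Phi_0 => B0.
by apply/eqP; rewrite eq_le B0 B_ge0.
Qed.

Lemma B_bounds n x : 0 < x -> 0 < B_ n x < xi.
Proof.
move=> x0; have /andP[FB BPhi] := (B_between n).2 x (ltW x0).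
rewrite (lt_le_trans (F_gt0 x0) FB) (le_lt_trans BPhi) //.
by have /andP[] := Phi_bounds x0.
Qed.

Lemma B_nonincreasing n x : 0 <= x -> B_ n.+1 x <= B_ n x.
Proof.
have [B0 _ BS] := B_approx.
elim: n x => [|n IH] x x0.
  by rewrite B0 //; have /andP[] := (B_between 1).2 x x0.
apply: Q_le_inv; rewrite ?B_ge0 // !BS //.
by apply: le_op_B => //; exact: B_admissible.
Qed.

(** This is the lower bound on [chi], free of the division by zero at [0]. *)
Lemma op_B_ge_op_Phi : continuous (derive1 K) ->
  [bounded derive1 K x | x in setT] ->
  exists2 s, 0 < s < 1 &
    forall x, 0 <= x -> s * op_Phi K mu Phi x <= op_B K omega2 Phi x.
Proof.
move=> cdK bdK.
have Phi_pos p : 0 < p -> exists2 m, 0 < m & forall t, p <= t -> m <= Phi t.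
  move=> p0; exists (F p); first exact: F_gt0.
  move=> t pt; have t0 := le_trans (ltW p0) pt.
  by rewrite (le_trans _ (F_le_Phi t0)) // F_nondecr // in_Rplus // ltW.
have [r [s [r0 s0 near0]]] :=
  op_B_ge_op_Phi_near0 Phi_admissible cdK bdK Phi_pos.
have Phi0 x : 0 <= x -> 0 <= op_Phi K mu Phi x.
  move=> x0; rewrite -Phi_eq // -Q_0 Q_homo //.
  by have /andP[] := Phi_admissible.2 x x0.
have QF0 : 0 < Q (F r).
  rewrite -Q_0 (increasing_lt_mono Q_incr) ?in_Rplus ?F_ge0 ?F_gt0 //.
  exact: ltW.
have xi0 : 0 < xi.
  have /andP[FPhi1 Phi1xi] := Phi_bounds ltr01.
  exact: lt_trans (lt_trans (F_gt0 ltr01) FPhi1) Phi1xi.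
have Qxi0 : 0 < Q xi.
  by rewrite -Q_0 (increasing_lt_mono Q_incr) ?in_Rplus // ltW.
pose s1 := Q (F r) / Q xi.
have s10 : 0 < s1 by rewrite divr_gt0.
(* 1 / 2 only serves to keep the constant below 1 *)
exists (Num.min (1 / 2) (Num.min s s1)).
  rewrite !lt_min s0 s10 gt_min divr_gt0 //=.
  by apply/orP; left; lra.
move=> x x0; have [xr|/ltW rx] := leP x r.
  apply: le_trans (near0 x _); last by rewrite x0.
  by rewrite ler_wpM2r ?Phi0 // !ge_min lexx /= orbT.
apply: (@le_trans _ _ (s1 * op_Phi K mu Phi x)).
  by rewrite ler_wpM2r ?Phi0 // !ge_min lexx !orbT.
apply: (@le_trans _ _ (Q (F r))).
  rewrite /s1 mulrAC ler_pdivrMr // ler_wpM2l ?(ltW QF0) //.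
  rewrite -Phi_eq // Q_homo //.
    by have /andP[] := Phi_admissible.2 x x0.
  by have /andP[] := Phi_admissible.2 x x0.
apply: (@le_trans _ _ (Q (F x))).
  by apply: Q_homo; rewrite ?F_ge0 ?F_nondecr // ?in_Rplus // ltW.
rewrite F_eq //; apply: op_F_le_op_B => // t; exact: F_le_Phi.
Qed.

Section contraction.
Variables (phi : R -> R) (s0 : R).
Hypothesis s0_01 : 0 < s0 < 1.
Hypothesis phi_01 : forall s, 0 < s < 1 -> s < phi s < 1.
Hypothesis phi_scale : forall s u w, 0 < s < 1 -> 0 < u < xi -> 0 <= w ->
  s * Q u <= Q w -> phi s * u <= w.
Hypothesis quotient_ge :
  forall x, 0 <= x -> s0 * op_Phi K mu Phi x <= op_B K omega2 Phi x.

Lemma iter_phi_bounds n : s0 <= iter n phi s0 < 1.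
Proof.
have /andP[s00 s01] := s0_01.
elim: n => [|n /andP[IH1 IH2]] /=; first by rewrite lexx.
have /phi_01/andP[/ltW h1 ->] : 0 < iter n phi s0 < 1.
  by rewrite IH2 (lt_le_trans s00).
by rewrite (le_trans IH1 h1).
Qed.

Lemma iter_phi_01 n : 0 < iter n phi s0 < 1.
Proof.
have /andP[s00 _] := s0_01; have /andP[h ->] := iter_phi_bounds n.
by rewrite (lt_le_trans s00 h).
Qed.

(** The case [x = 0] is separate because [phi_scale] needs [0 < B_ n x]. *)
Lemma B_ratio n x : 0 <= x -> iter n.+1 phi s0 * B_ n x <= B_ n.+1 x.
Proof.
have [B0 _ BS] := B_approx.
elim: n x => [|n IH] x; rewrite le_eqVlt => /predU1P[<-|x_gt0];
  try by rewrite !B_at0 mulr0.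
- have x0 := ltW x_gt0; apply: phi_scale; rewrite ?B_bounds ?B_ge0 //.
  rewrite BS // B0 // Phi_eq //; apply: (le_trans (quotient_ge x0)).
  apply: le_op_B => //; first exact: B_admissible.
  by move=> t t0; rewrite B0.
have x0 := ltW x_gt0; rewrite [iter _ _ _]iterS.
apply: phi_scale; rewrite ?B_bounds ?B_ge0 //; first exact: iter_phi_01.
rewrite !BS //; apply: op_B_scale => //; try exact: B_admissible.
by have /andP[/ltW -> /ltW ->] := iter_phi_01 n.+1.
Qed.

Lemma B_step_le k : 0 < k < 1 ->
  (forall s, s0 <= s < 1 -> 1 - phi s <= k * (1 - s)) ->
  forall n x, 0 <= x -> B_ n x - B_ n.+1 x <= xi * (1 - s0) * k ^+ n.+1.
Proof.
move=> /andP[k0 k1] phik n x x0.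
have rate j : 1 - iter j phi s0 <= (1 - s0) * k ^+ j.
  elim: j => [|j IH]; first by rewrite expr0 mulr1.
  rewrite iterS exprS mulrCA; apply: (le_trans (phik _ (iter_phi_bounds j))).
  by rewrite ler_wpM2l // ltW.
have /andP[B0 Bxi] := (B_admissible n).2 x x0.
apply: (@le_trans _ _ ((1 - iter n.+1 phi s0) * B_ n x)).
  by rewrite mulrBl mul1r lerB // B_ratio.
rewrite -mulrA mulrC; apply: ler_pM => //.
by rewrite subr_ge0 ltW //; have /andP[] := iter_phi_01 n.+1.
Qed.

Lemma B_geometric k : 0 < k < 1 ->
  (forall s, s0 <= s < 1 -> 1 - phi s <= k * (1 - s)) ->
  forall x, 0 <= x -> B_ n x @[n --> \oo] --> limn (B_ ^~ x) /\
  forall n, 0 <= B_ n x - limn (B_ ^~ x) <= xi * (1 - s0) / (1 - k) * k ^+ n.+1.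
Proof.
move=> k01 phik x x0.
have c0 : 0 <= xi * (1 - s0).
  have /andP[_ s01] := s0_01.
  have /andP[/le_trans + Bxi] := (B_admissible 0%N).2 x x0.
  by move=> /(_ _ Bxi) xi0; rewrite mulr_ge0 // subr_ge0 ltW.
have [l Bl Hl] := geometric_decrease k01 c0
  (fun n => B_nonincreasing n x0) (fun n => B_step_le k01 phik n x0).
by rewrite (cvg_lim _ Bl).
Qed.

End contraction.

(** [T (B_ n + omega2 B_ n) = Q (B_ n.+1)] tends to [Q B], and it is squeezed
    between the convolution for [B] and that value plus a multiple of
    [e n]. *)
Lemma limit_solution (B : R -> R) (e : nat -> R) :
  (forall x, 0 <= x -> B_ n x @[n --> \oo] --> B x) ->
  (forall n x, 0 <= x -> 0 <= B_ n x - B x <= e n) ->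
  e n @[n --> \oo] --> (0 : R) ->
  [/\ {within Rplus, continuous B},
      forall x, 0 <= x -> F x <= B x <= Phi x &
      forall x, 0 <= x -> Q (B x) = op_B K omega2 B x].
Proof.
move=> BB Be e0.
have cB : {within Rplus, continuous B}.
  apply: (uniform_limit_continuous (fun n => (B_between n).1) _ e0).
  by move=> n x x0; have /andP[h1 h2] := Be n x x0; rewrite ger0_norm.
have FBPhi x : 0 <= x -> F x <= B x <= Phi x.
  move=> x0; apply/andP; split.
    apply: (cvgr_to_ge (BB x x0)) => //.
    by apply: nearW => n; have /andP[] := (B_between n).2 x x0.
  have /andP[h _] := Be 0%N x x0; have [B0 _ _] := B_approx.
  by rewrite -B0 // -subr_ge0.
split=> // x x0.
have [B0 _ BS] := B_approx.
have aB := between_admissible cB FBPhi.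
have QB : Q (B_ n.+1 x) @[n --> \oo] --> Q (B x).
  have Bx0 : 0 <= B x by have /andP[] := aB.2 x x0.
  apply/cvgrPdist_lt => d d0.
  have /continuous_RplusP /(_ _ Bx0 _ d0)[r r0 Hr] := Q_continuous.
  have := BB x x0; rewrite -cvg_shiftS => /cvgrPdist_lt /(_ _ r0).
  by apply: filterS => n; apply: Hr; rewrite B_ge0.
have TB : Q (B_ n.+1 x) @[n --> \oo] --> op_B K omega2 B x.
  pose T1 := odd_convolution K (fun t => 1 + mu t) x.
  apply: (@squeeze_cvgr _ _ _ _ (fun=> op_B K omega2 B x)
    (fun n => op_B K omega2 B x + e n * T1)).
  - apply: nearW => n; rewrite BS // le_op_B //=; last 2 first.
    + exact: B_admissible.
    + by move=> t t0; have /andP[] := Be n t t0; rewrite subr_ge0.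
    rewrite -lerBlDl; exact: (op_B_lipschitz (B_admissible n) aB (Be n) x0).
  - exact: cvg_cst.
  - rewrite -[X in _ --> X]addr0 -[X in _ + X](mul0r T1).
    by apply: cvgD; [exact: cvg_cst|apply: cvgM => //; exact: cvg_cst].
exact: cvg_unique QB TB.
Qed.

End iteration.
End superposition.
End kernel.

(** * Existence of the solution and rate of convergence *)


Theorem theorem2 (R : realType)
  (K : R -> R) (omega2 : R -> R -> R) (Q : R -> R)
  (* 1) *)
  (K_gt0 : forall x, 0 < K x)
  (K_even : forall t, 0 <= t -> K (- t) = K t)
  (K_derivable : forall x, derivable K x 1)
  (K'_continuous : continuous (derive1 K))
  (K_bounded : [bounded K x | x in setT])
  (K'_bounded : [bounded derive1 K x | x in setT])
  (* 2) *)
  (K_decr : decreasing_on Rplus K)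
  (K_mass : (\int[@lebesgue_measure R]_(t in Rplus) (K t)%:E
             = (2^-1 : R)%:E)%E)
  (* 3) *)
  (K_moment : (\int[@lebesgue_measure R]_(x in Rplus) (x * K x)%:E < +oo)%E)
  (* 0) *)
  (Q_0 : Q 0 = 0)
  (omega2_0 : forall t, 0 <= t -> omega2 t 0 = 0)
  (* b1) *)
  (omega2_continuous :
    {within Rplus `*` Rplus, continuous (fun p : R * R => omega2 p.1 p.2)})
  (omega2_incr : forall t, 0 <= t -> increasing_on Rplus (omega2 t))
  (omega2_concave : forall t, 0 <= t -> concave_on Rplus (omega2 t))
  (* b2) *)
  (mu2 : R -> R)
  (mu2_gt0 : forall t, 0 <= t -> 0 < mu2 t)
  (mu2_summable : (@lebesgue_measure R).-integrable Rplus (EFin \o mu2))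
  (mu2_lim : mu2 t @[t --> +oo] --> (0 : R))
  (omega2_le : forall t u, 0 <= t -> 0 <= u -> omega2 t u <= mu2 t * u)
  (* I) *)
  (Q_ge0 : forall u, 0 <= u -> 0 <= Q u)
  (Q_continuous : {within Rplus, continuous Q})
  (Q_incr : increasing_on Rplus Q)
  (* II) *)
  (Q_convex : convex_function (Rplus : set R^o) (Q : R^o -> R^o))
  (xi : R) (xi_gt0 : 0 < xi) (Q_xi : Q xi = (1 + mass K mu2) * xi)
  (* III) G is the inverse of Q on Rplus; the last condition on phi excludes
     the identity map, for which k = 1 *)
  (G : R -> R)
  (G_ge0 : forall u, 0 <= u -> 0 <= G u)
  (GK : {in Rplus, cancel G Q})
  (QK : {in Rplus, cancel Q G})
  (phi : R -> R)
  (phi_01 : forall s, 0 <= s <= 1 -> 0 <= phi s <= 1)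
  (phi_continuous : {within `[0, 1], continuous phi})
  (phi_incr : increasing_on `[0, 1] phi)
  (phi_concave : concave_on `[0, 1] phi)
  (phi_0 : phi 0 = 0) (phi_1 : phi 1 = 1)
  (G_phi : forall s u, 0 < s < 1 -> 0 < u < (1 + mass K mu2) * xi ->
    phi s * G u <= G (s * u))
  (phi_not_id : exists2 s, 0 < s < 1 & phi s != s)
  (* the fixed point eta and the functions F, Phi, with the properties known
     for them *)
  (eta : R) (eta_gt0 : 0 < eta) (Q_eta : Q eta = eta)
  (F : R -> R)
  (F_solution : is_solution Q (op_F K) F)
  (F_nondecr : {in Rplus &, {homo F : x y / x <= y}})
  (F_0 : F 0 = 0)
  (F_gt0 : forall x, 0 < x -> 0 < F x)
  (F_lim : F x @[x --> +oo] --> eta)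
  (F_L1 : (@lebesgue_measure R).-integrable Rplus
            (EFin \o (fun x => eta - F x)))
  (Phi : R -> R)
  (Phi_solution : is_solution Q (op_Phi K mu2) Phi)
  (Phi_0 : Phi 0 = 0)
  (Phi_bounds : forall x, 0 < x -> F x < Phi x < xi)
  (Phi_lim : Phi x @[x --> +oo] --> eta)
  (Phi_L1 : (@lebesgue_measure R).-integrable Rplus
              (EFin \o (fun x => eta - Phi x)))
  (B_ : nat -> R -> R)
  (B_approx : successive_approximations Q (op_B K omega2) Phi B_) :
  exists B : R -> R,
    [/\ is_solution Q (op_B K omega2) B,
        forall x, 0 <= x -> B_ n x @[n --> \oo] --> B x,
        exists sigma0 : R,
          [/\ 0 < sigma0 < 1,
              forall x, 0 < x -> sigma0 <= chi K omega2 mu2 Phi x <= 1 &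
              forall eps0 : R, 0 < eps0 < 1 ->
                let k := (1 - phi (eps0 * sigma0)) / (1 - eps0 * sigma0) in
                let C := xi * (1 - sigma0) / (1 - k) in
                0 < k < 1 /\
                forall (n : nat) (x : R), 0 <= x ->
                  0 <= B_ n x - B x <= C * k ^+ n.+1] &
        [/\ forall x, 0 <= x -> F x <= B x <= Phi x,
            B x @[x --> +oo] --> eta &
            (@lebesgue_measure R).-integrable Rplus
              (EFin \o (fun x => eta - B x))]].
Proof.
have inR z : 0 <= z -> z \in (Rplus : set R) by rewrite in_Rplus.
have [F_ge0 _ F_cont _ F_eq] := F_solution.
have [Phi_ge0 _ Phi_cont _ Phi_eq] := Phi_solution.
have Phi_xi x : 0 <= x -> Phi x <= xi.
  rewrite le_eqVlt => /predU1P[<-|/Phi_bounds/andP[_ /ltW //]].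
  by rewrite Phi_0 ltW.
have F_xi x : 0 <= x -> F x <= xi.
  rewrite le_eqVlt => /predU1P[<-|x0]; first by rewrite F_0 ltW.
  by have /andP[FPhi Phixi] := Phi_bounds x x0; exact/ltW/(lt_trans FPhi).
have F_adm : admissible xi F by split=> // x x0; rewrite F_ge0 ?F_xi.
have Phi_adm : admissible xi Phi by split=> // x x0; rewrite Phi_ge0 ?Phi_xi.
have [s0 s0_01 quot] := op_B_ge_op_Phi K_gt0 K_even K_derivable K_decr K_mass
  mu2_gt0 mu2_summable omega2_0 omega2_continuous omega2_incr omega2_le
  Q_incr Q_0 F_adm F_nondecr F_gt0 F_eq Phi_adm Phi_0 Phi_bounds Phi_eq
  K'_continuous K'_bounded.
have /andP[s0_gt0 s0_lt1] := s0_01.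
have phi_above (s : R) : 0 < s < 1 -> s < phi s < 1.
  move=> s01; rewrite (concave_above_id phi_concave) //=.
  have /andP[s_gt0 s_lt1] := s01.
  rewrite -phi_1 phi_incr // inE /= in_itv /= ?ler01 ?lexx //.
  by rewrite (ltW s_gt0) (ltW s_lt1).
have phi_scale (s u w : R) : 0 < s < 1 -> 0 < u < xi -> 0 <= w ->
    s * Q u <= Q w -> phi s * u <= w.
  apply: (inverse_scale Q_incr Q_0 G_ge0 GK QK).
  by rewrite Q_xi.
pose k_ (e : R) := (1 - phi (e * s0)) / (1 - e * s0).
have es0_01 (e : R) : 0 < e < 1 -> 0 < e * s0 <= s0 /\ e * s0 < 1.
  move=> /andP[e0 e1]; rewrite mulr_gt0 // ler_piMl ?(ltW e1) ?(ltW s0_gt0) //.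
  by split=> //; nra.
have k_01 (e : R) : 0 < e < 1 -> 0 < k_ e < 1.
  move=> /es0_01[/andP[es0 _] es1].
  have /andP[h1 h2] := phi_above _ (introT andP (conj es0 es1)).
  rewrite /k_ divr_gt0 ?subr_gt0 //= ltr_pdivrMr ?subr_gt0 // mul1r.
  by rewrite ltrD2l ltrN2.
have k_chord (e : R) : 0 < e < 1 ->
    forall s, s0 <= s < 1 -> 1 - phi s <= k_ e * (1 - s).
  move=> /es0_01[/andP[es0 es0s] es1] s /andP[s0s s1].
  by apply: concave_chord => //; rewrite ?(ltW es0) // (le_trans es0s) //= ltW.
have geom (e : R) (e01 : 0 < e < 1) := B_geometric K_gt0 K_even K_derivable
  K_decr K_mass mu2_gt0 mu2_summable omega2_0 omega2_continuous omega2_incr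
  omega2_concave omega2_le Q_incr Q_0 F_adm F_gt0 F_eq Phi_adm Phi_0
  Phi_bounds Phi_eq B_approx s0_01 phi_above phi_scale quot
  (k_01 e e01) (k_chord e e01).
(* any eps0 gives the convergence; the limit does not depend on it *)
have half01 : 0 < (1 / 2 : R) < 1 by lra.
pose B x := limn (B_ ^~ x).
have BB x : 0 <= x -> B_ n x @[n --> \oo] --> B x.
  by move=> /(geom _ half01)[].
have rate_cvg : xi * (1 - s0) / (1 - k_ (1 / 2)) * k_ (1 / 2) ^+ n.+1
    @[n --> \oo] --> (0 : R).
  rewrite -[X in _ --> X](mulr0 (xi * (1 - s0) / (1 - k_ (1 / 2)))).
  apply: cvgM; first exact: cvg_cst.
  rewrite (cvg_shiftS (fun n => k_ (1 / 2) ^+ n)).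
  have /andP[k0 k1] := k_01 _ half01.
  by apply: cvg_expr; rewrite ger0_norm // ltW.
have [B_cont B_between B_eq] := limit_solution K_gt0 K_even K_derivable K_decr
  K_mass mu2_gt0 mu2_summable omega2_0 omega2_continuous omega2_incr
  omega2_concave omega2_le Q_incr Q_continuous Q_0 F_adm F_eq Phi_adm
  Phi_0 Phi_bounds Phi_eq B_approx BB
  (fun n x x0 => (geom _ half01 x x0).2 n) rate_cvg.
have B_ge0 x : 0 <= x -> 0 <= B x.
  by move=> x0; have /andP[/(le_trans (F_ge0 x x0))] := B_between x x0.
exists B; split=> //.
- split=> //.
  + exists 1 => //; rewrite gt_eqF //.
    have /andP[+ _] := B_between 1 ler01.
    exact/lt_le_trans/F_gt0/ltr01.
  + apply/bounded_onP; exists xi => x; rewrite RplusE => x0.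
    rewrite ger0_norm ?B_ge0 //; have /andP[_] := B_between x x0.
    by move=> /le_trans; apply; exact: Phi_xi.
- exists s0; split=> //.
  + move=> x x_gt0; have x0 := ltW x_gt0.
    have Phi_gt0 : 0 < Phi x.
      by have /andP[+ _] := Phi_bounds x x_gt0; exact/lt_trans/F_gt0.
    have D0 : 0 < op_Phi K mu2 Phi x.
      by rewrite -Phi_eq // -Q_0 Q_incr ?inR ?Phi_ge0.
    rewrite /chi ler_pdivlMr // quot //= ler_pdivrMr // mul1r.
    exact: (op_B_le_op_Phi K_gt0 K_even K_derivable K_decr K_mass mu2_gt0
      mu2_summable omega2_0 omega2_continuous omega2_incr omega2_concave
      omega2_le Phi_adm Phi_adm).
  + move=> e e01; split; first exact: k_01.
    by move=> n x x0; have [_] := geom e e01 x x0; exact.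
- split=> //.
  + apply: (squeeze_cvgr _ F_lim Phi_lim).
    by near=> x; apply: B_between; near: x; exact: nbhs_pinfty_ge.
  + have iFP := integrableD measurable_Rplus (integrable_norm F_L1)
      (integrable_norm Phi_L1).
    apply: (le_integrable measurable_Rplus _ _ iFP).
      apply/measurable_EFinP; apply: measurable_funB.
        exact: measurable_cst.
      exact: measurable_fun_Rplus.
    move=> x; rewrite RplusE => x0 /=; rewrite lee_fin.
    have /andP[h1 h2] := B_between x x0.
    rewrite [leRHS]ger0_norm ?addr_ge0 // ler_norml.
    have := ler_norm (eta - F x); have := ler_norm (- (eta - Phi x)).
    have := normr_ge0 (eta - F x); have := normr_ge0 (eta - Phi x).
    by rewrite normrN => *; apply/andP; split; lra.
Unshelve. all: by end_near.
Qed.
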